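(* Let $C_1,C_2,C_3,C_5,C_6,C_7$ be real constants and set $$\alpha(\rho)=-\frac{1}{\rho(C_3\rho-1)},\qquad \beta(\rho)=\frac{C_2}{\rho(C_3\rho-1)},\qquad A(\rho)=C_1+\frac{C_5}{\rho^3}\left(C_3+\frac{C_7}{\rho}\right)^{C_6}.$$ Then the overdetermined system of partial differential equations for two unknown functions $u(t,x)$, $\rho(t,x)$ $$u_t+uu_x+A(\rho)\rho_x=0,\qquad \rho_t+(\rho u)_x=0,\qquad u_x-\rho_x\left(\alpha(\rho)u+\beta(\rho)\right)=0$$ is compatible.
   Context: The first two equations are the one-dimensional Euler equations for a homentropic gas flow ($u$ is the velocity, $\rho>0$ the density, $A(\rho)=p'(\rho)/\rho$ with $p$ the pressure); the third is an added differential constraint. All functions are considered where they are defined: $\rho>0$, $C_3\rho\neq 1$, $C_3+C_7/\rho>0$. The system is regarded as a submanifold $\mathcal E$ of the space $J^1$ of 1-jets of pairs of functions $(u,\rho)$ of $(t,x)$, given by three equations $F_1=F_2=F_3=0$; $\dim J^1=8$, $\dim\mathcal E=5$, and $(t,x,u,\rho,\rho_x)$ are coordinates on $\mathcal E$. Compatibility means that the differential consequences of the system, obtained by applying the total derivatives $D_t,D_x$ to the equations any number of times and eliminating higher-order derivatives, impose no further relations on the first-order jets. This is understood over the open part of $\mathcal E$ where $$(C_2-u)^2-\rho A(\rho)(C_3\rho-1)^2\neq 0.$$ There the first prolongation (the six equations $D_tF_i=0$, $D_xF_i=0$) determines all second-order derivatives of $u,\rho$ as functions on $\mathcal E$. Compatibility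 then means that the resulting rank-2 Cartan distribution on $\mathcal E$ (spanned by the total derivatives with these second-order derivatives substituted) is completely integrable in the sense of Frobenius; equivalently, through every point of this part of $\mathcal E$ there passes the 1-jet of a local solution. *)

(* Defs.v *)
From HB Require Import structures.
From mathcomp Require Import all_boot all_order all_algebra.
From mathcomp Require Import all_classical all_reals all_analysis.

Set Implicit Arguments.
Unset Strict Implicit.
Unset Printing Implicit Defensive.

Import Order.TTheory GRing.Theory Num.Theory.
Import numFieldNormedType.Exports.

Local Open Scope classical_set_scope.
Local Open Scope ring_scope.

Section Distributions.
Context {R : realType} {n k : nat}.
Implicit Types (X Y : 'rV[R]_n -> 'rV[R]_n) (p : 'rV[R]_n).

Definition lie_bracket X Y p : 'rV[R]_n := 'D_(X p) Y p - 'D_(Y p) X p.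

(* A distribution is given by k generating vector fields; its value at p is
   the row space of this matrix. *)
Definition distr_mx (X : 'I_k -> 'rV[R]_n -> 'rV[R]_n) p : 'M[R]_(k, n) :=
  \matrix_(i < k) X i p.

Definition involutive_fields (U : set 'rV[R]_n) (X : 'I_k -> 'rV[R]_n -> 'rV[R]_n) :=
  forall p, U p ->
    (forall i, differentiable (X i) p) /\
    (forall i j, (lie_bracket (X i) (X j) p <= distr_mx X p)%MS).

(* s is a C^1 local parametrization, defined near 0, of an integral manifold
   through p: its tangent space at s v is the distribution at s v. *)
Definition integral_manifold_at (U : set 'rV[R]_n)
    (X : 'I_k -> 'rV[R]_n -> 'rV[R]_n) p (s : 'rV[R]_k -> 'rV[R]_n) :=
  s 0 = p /\
  \forall v \near (0 : 'rV[R]_k),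
    [/\ U (s v), differentiable s v, {for v, continuous (jacobian s)} &
        (jacobian s v == distr_mx X (s v))%MS].

(* Both sides of the Frobenius theorem, for a distribution of rank k. *)
Definition completely_integrable (U : set 'rV[R]_n)
    (X : 'I_k -> 'rV[R]_n -> 'rV[R]_n) :=
  [/\ forall p, U p -> \rank (distr_mx X p) = k,
      involutive_fields U X &
      forall p, U p -> exists s, integral_manifold_at U X p s].

End Distributions.

Section Jets.
Context {R : realType}.

(* 1-jets of (u, rho) at (t, x): rows
     (t, x, u, rho, u_t, u_x, rho_t, rho_x);
   second-order derivatives: rows
     (u_tt, u_tx, u_xx, rho_tt, rho_tx, rho_xx). *)

Definition row_of (n : nat) (s : seq R) : 'rV[R]_n := \row_(i < n) s`_i.

Definition crd_t (a : 'rV[R]_8) : R := a ord0 (inord 0).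
Definition crd_x (a : 'rV[R]_8) : R := a ord0 (inord 1).
Definition crd_u (a : 'rV[R]_8) : R := a ord0 (inord 2).
Definition crd_rho (a : 'rV[R]_8) : R := a ord0 (inord 3).
Definition crd_ut (a : 'rV[R]_8) : R := a ord0 (inord 4).
Definition crd_ux (a : 'rV[R]_8) : R := a ord0 (inord 5).
Definition crd_rhot (a : 'rV[R]_8) : R := a ord0 (inord 6).
Definition crd_rhox (a : 'rV[R]_8) : R := a ord0 (inord 7).

Definition crd_utt (h : 'rV[R]_6) : R := h ord0 (inord 0).
Definition crd_utx (h : 'rV[R]_6) : R := h ord0 (inord 1).
Definition crd_uxx (h : 'rV[R]_6) : R := h ord0 (inord 2).
Definition crd_rhott (h : 'rV[R]_6) : R := h ord0 (inord 3).
Definition crd_rhotx (h : 'rV[R]_6) : R := h ord0 (inord 4).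
Definition crd_rhoxx (h : 'rV[R]_6) : R := h ord0 (inord 5).

(* The total derivatives D_t and D_x as tangent vectors to the space of 1-jets
   at a, for the second-order derivatives h. *)
Definition total_t (a : 'rV[R]_8) (h : 'rV[R]_6) : 'rV[R]_8 :=
  row_of 8 [:: 1; 0; crd_ut a; crd_rhot a;
               crd_utt h; crd_utx h; crd_rhott h; crd_rhotx h].
Definition total_x (a : 'rV[R]_8) (h : 'rV[R]_6) : 'rV[R]_8 :=
  row_of 8 [:: 0; 1; crd_ux a; crd_rhox a;
               crd_utx h; crd_uxx h; crd_rhotx h; crd_rhoxx h].

Definition equation_set (m : nat) (F : 'I_m -> 'rV[R]_8 -> R) : set 'rV[R]_8 :=
  [set a | forall i, F i a = 0].

(* D_t F_i = 0 and D_x F_i = 0 at the 2-jet (a, h). *)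
Definition prolonged (m : nat) (F : 'I_m -> 'rV[R]_8 -> R)
    (a : 'rV[R]_8) (h : 'rV[R]_6) : Prop :=
  forall i, 'D_(total_t a h) (F i) a = 0 /\ 'D_(total_x a h) (F i) a = 0.

(* The coordinates (t, x, u, rho, rho_x) on the equation.  This map is linear,
   so it also gives the components of a tangent vector in these coordinates. *)
Definition coordE (a : 'rV[R]_8) : 'rV[R]_5 :=
  row_of 5 [:: crd_t a; crd_x a; crd_u a; crd_rho a; crd_rhox a].

(* The fields spanning the Cartan distribution, written in the coordinates
   coordE: [param] is the inverse of coordE on the equation and [S] gives the
   second-order derivatives. *)
Definition cartan_field (param : 'rV[R]_5 -> 'rV[R]_8)
    (S : 'rV[R]_8 -> 'rV[R]_6) (i : 'I_2) (p : 'rV[R]_5) : 'rV[R]_5 :=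
  let a := param p in
  coordE (if i == ord0 then total_t a (S a) else total_x a (S a)).

(* Compatibility over the part of the equation lying in W, for a system whose
   equation set is parametrized by [param] in the coordinates coordE. *)
Definition compatible_on (m : nat) (F : 'I_m -> 'rV[R]_8 -> R)
    (param : 'rV[R]_5 -> 'rV[R]_8) (W : set 'rV[R]_8) : Prop :=
  [/\ forall a, equation_set F a <-> exists p, a = param p,
      forall p, coordE (param p) = p &
      exists S : 'rV[R]_8 -> 'rV[R]_6,
        (forall a, equation_set F a -> W a ->
           forall h, prolonged F a h <-> h = S a) /\
        completely_integrable [set p | W (param p)] (cartan_field param S)].

End Jets.

Section Euler.
Context {R : realType}.

Definition alpha (C3 r : R) : R := - (r * (C3 * r - 1))^-1.

Definition beta (C2 C3 r : R) : R := C2 / (r * (C3 * r - 1)).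

Definition Afun (C1 C3 C5 C6 C7 r : R) : R :=
  C1 + C5 / r ^+ 3 * (C3 + C7 / r) `^ C6.

Definition system (al be A : R -> R) (i : 'I_3) (a : 'rV[R]_8) : R :=
  [:: crd_ut a + crd_u a * crd_ux a + A (crd_rho a) * crd_rhox a;
      crd_rhot a + (crd_rhox a * crd_u a + crd_rho a * crd_ux a);
      crd_ux a - crd_rhox a * (al (crd_rho a) * crd_u a + be (crd_rho a))]`_i.

Definition system_param (al be A : R -> R) (p : 'rV[R]_5) : 'rV[R]_8 :=
  let t := p ord0 (inord 0) in let x := p ord0 (inord 1) in
  let u := p ord0 (inord 2) in let r := p ord0 (inord 3) in
  let rx := p ord0 (inord 4) in
  let ux := rx * (al r * u + be r) in
  row_of 8 [:: t; x; u; r; - (u * ux + A r * rx); ux; - (rx * u + r * ux); rx].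

Definition regular_part (C1 C2 C3 C5 C6 C7 : R) : set 'rV[R]_8 :=
  [set a | let u := crd_u a in let r := crd_rho a in
     [/\ 0 < r, C3 * r != 1, 0 < C3 + C7 / r &
         (C2 - u) ^+ 2 - r * Afun C1 C3 C5 C6 C7 r * (C3 * r - 1) ^+ 2 != 0]].

End Euler.

(* Main.v *)
(* Write w = u - C2 and f = w (C3 - 1/rho).  On solutions f_x = 0 and f_t is a
   constant a, so f is affine in t and u = C2 + f rho / (C3 rho - 1).  The system
   then makes a dx an exact 1-form in (t, rho), and integrating it gives x
   explicitly as a function of (t, rho), up to an antiderivative of
   A(rho) (C3 rho - 1) / rho.  Integral manifolds are therefore written down
   directly, parametrized by (t, rho) when rho_x <> 0 and by (t, x), with u and
   rho constant, when rho_x = 0; neither the Frobenius theorem nor the implicit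
   function theorem is needed. *)

Require Import Defs.
From HB Require Import structures.
From mathcomp Require Import all_boot all_order all_algebra.
From mathcomp Require Import all_classical all_reals all_analysis.
From mathcomp Require Import ring lra.

Set Implicit Arguments.
Unset Strict Implicit.
Unset Printing Implicit Defensive.

Import Order.TTheory GRing.Theory Num.Theory.
Import numFieldNormedType.Exports.

Local Open Scope classical_set_scope.
Local Open Scope ring_scope.

(** Write q = C3 rho - 1, so that f = (u - C2) q / rho. The constraint is then (rho / q) f_x = 0,
    and the Euler equations give f_t = N rho_x with N = [invar_rate]. The discriminant required to
    be nonzero is N rho^2 q. Hence the cross derivative f_xt = 0, that is N rho_xx + N_rho rho_x^2 =
    0 with N_rho taken at constant f, determines rho_xx. The x-derivative of the continuity equation
    then gives rho_tx, and with these two values D_t (N rho_x) vanishes identically: this is why f_t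
    is constant and why no further condition appears. Complete integrability asks for involutivity
    as well as for integral manifolds, so the Lie bracket is also computed in coordinates. The core
    is carried out for a twice differentiable A on an open set O avoiding 0; the pressure law is
    substituted at the end. *)

(* Unlike [is_diff], this is not a typeclass: instance resolution would replace
   the pointwise differentials below by combinations of functions. *)
Definition has_diff (R : realType) (V W : normedModType R) (p : V)
    (f df : V -> W) : Prop := is_diff p f df.

(** * Calculus of differentials at a point *)

Section PointwiseDifferentials.
Context {R : realType} {V : normedModType R}.
Implicit Types (f g df dg : V -> R) (p : V).

Lemma derive_has_diff (W : normedModType R) (f df : V -> W) p v :
  has_diff p f df -> 'D_v f p = df v.
Proof. by move=> [fd fE]; rewrite deriveE// fE. Qed.

Lemma has_diff_ext (W : normedModType R) (f df dg : V -> W) p :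
  has_diff p f df -> df =1 dg -> has_diff p f dg.
Proof. by move=> fdf /funext <-. Qed.

Lemma has_diff_cst (c : R) p : has_diff p (fun=> c) (fun=> 0 : R).
Proof. exact: is_diff_cst. Qed.

Lemma has_diff_add f g df dg p : has_diff p f df -> has_diff p g dg ->
  has_diff p (fun y => f y + g y) (fun v => df v + dg v).
Proof. exact: is_diffD. Qed.

Lemma has_diff_opp f df p : has_diff p f df ->
  has_diff p (fun y => - f y) (fun v => - df v).
Proof. exact: is_diffN. Qed.

Lemma has_diff_mul f g df dg p : has_diff p f df -> has_diff p g dg ->
  has_diff p (fun y => f y * g y) (fun v => f p * dg v + df v * g p).
Proof.
move=> fdf gdg; apply: has_diff_ext (is_diffM fdf gdg) _ => v.
by rewrite !fctE [_ *: df v]mulrC.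
Qed.

Lemma has_diff_exp f df p n : has_diff p f df ->
  has_diff p (fun y => f y ^+ n.+1) (fun v => n.+1%:R * f p ^+ n * df v).
Proof.
move=> fdf; have := is_diffX n fdf.
by rewrite (_ : f ^+ n.+1 = (fun y => f y ^+ n.+1)) // exprfctE.
Qed.

Lemma has_diff_inv f df p : f p != 0 -> has_diff p f df ->
  has_diff p (fun y => (f y)^-1) (fun v => - (f p)^-2 * df v).
Proof.
move=> fp [fd fE]; apply: DiffDef; first exact: differentiableV.
by rewrite diffV// fE.
Qed.

(** The outer function is given by a scalar derivative, the form in which A, its derivative, real
    powers and antiderivatives are available. *)
Lemma has_diff_comp f df p (g : R -> R) (dg : R) :
  is_derive (f p) 1 g dg -> has_diff p f df ->
  has_diff p (fun y => g (f y)) (fun v => dg * df v).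
Proof.
move=> gdg fdf.
have gd : is_diff (f p) g (fun h => dg * h).
  apply: DiffDef; first exact/derivable1_diffP.
  by rewrite deriv1E// derive1E derive_val; apply/funext => h; rewrite mulrC.
exact: is_diff_comp.
Qed.

End PointwiseDifferentials.

(** * Differentials and continuity of row- and matrix-valued maps *)

Section MatrixDifferentials.
Context {R : realType}.

Lemma has_diff_coord n (p : 'rV[R]_n) i :
  has_diff p (fun y : 'rV[R]_n => y ord0 i) (fun v => v ord0 i).
Proof.
apply: DiffDef; first exact: differentiable_coord.
apply/funext => v; rewrite -deriveE; last exact: differentiable_coord.
have /derive_mx : derivable (id : 'rV[R]_n -> 'rV[R]_n) p v by [].
by rewrite derive_id => /matrixP/(_ ord0 i); rewrite mxE.
Qed.

(** Expanding f in the standard basis gives differentiability as a finite sum; only then can the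
    differential be read off entrywise as a directional derivative. *)
Lemma has_diff_row (V : normedModType R) n (f df : V -> 'rV[R]_n) p :
  (forall i, has_diff p (fun y => f y ord0 i) (fun v => df v ord0 i)) ->
  has_diff p f df.
Proof.
move=> fdf.
have fE : f = \sum_(i < n) (fun y => f y ord0 i *: delta_mx ord0 i).
  by apply/funext => y; rewrite fct_sumE; exact: row_sum_delta.
have fid i : differentiable (fun y => f y ord0 i) p by have [] := fdf i.
have fd : differentiable f p.
  by rewrite fE; apply: differentiable_sum => i; apply: differentiableZl.
apply: DiffDef => //; apply/funext => v; rewrite -deriveE//.
rewrite derive_mx; last exact: diff_derivable.
by apply/rowP => i; rewrite mxE (derive_has_diff _ (fdf i)).
Qed.

Lemma continuous_mx (T : topologicalType) m n (M : T -> 'M[R]_(m, n)) x :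
  (forall i j, {for x, continuous (fun y => M y i j)}) -> {for x, continuous M}.
Proof.
move=> Mc; apply/cvgrPdist_le => /= e e0; near=> y.
rewrite /Num.Def.normr/= mx_normrE (bigmax_le _ (ltW e0))//= => i _.
rewrite !mxE/=.
move: i; near: y; apply: filter_forall => /= i.
exact: ((cvgrPdist_le _ _).1 (Mc i.1 i.2)).
Unshelve. all: by end_near. Qed.

Lemma row_ofE n (s : seq R) k : (k < n.+1)%N ->
  row_of n.+1 s ord0 (inord k) = s`_k.
Proof. by move=> kn; rewrite mxE inordK. Qed.

Lemma has_diff_row_of5 (V : normedModType R) (p : V)
    (f0 f1 f2 f3 f4 d0 d1 d2 d3 d4 : V -> R) :
  has_diff p f0 d0 -> has_diff p f1 d1 -> has_diff p f2 d2 ->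
  has_diff p f3 d3 -> has_diff p f4 d4 ->
  has_diff p (fun y => row_of 5 [:: f0 y; f1 y; f2 y; f3 y; f4 y])
    (fun v => row_of 5 [:: d0 v; d1 v; d2 v; d3 v; d4 v]).
Proof.
move=> h0 h1 h2 h3 h4; apply: has_diff_row => i.
under [X in has_diff _ X]eq_fun do rewrite mxE.
under [X in has_diff _ _ X]eq_fun do rewrite mxE.
by case: i => -[|[|[|[|[|//]]]]].
Qed.

End MatrixDifferentials.

(** * Integral manifolds from a frame, and local antiderivatives *)

Lemma has_diff_continuous (R : realType) (V W : normedModType R)
    (f df : V -> W) p :
  has_diff p f df -> {for p, continuous f}.
Proof. by case=> fd _; exact: differentiable_continuous. Qed.

Lemma continuous_bigsum (R : realType) (T : topologicalType) (I : Type)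
    (r : seq I) (F : I -> T -> R) x :
  (forall i, {for x, continuous (F i)}) ->
  {for x, continuous (fun y => \sum_(i <- r) F i y)}.
Proof.
move=> Fc; elim: r => [|i r IHr].
  rewrite (_ : (fun _ => _) = cst 0); first exact: cst_continuous.
  by apply/funext => y; rewrite big_nil.
rewrite (_ : (fun _ => _) = F i \+ (fun y => \sum_(j <- r) F j y)).
  exact: continuousD.
by apply/funext => y; rewrite big_cons.
Qed.

(** It suffices to factor the Jacobian of s as an invertible matrix M times the matrix of the
    fields: invertibility gives equality of row spaces, and continuity of M, of the fields and of s
    gives continuity of the Jacobian. *)
Lemma integral_manifold_frame (R : realType) (n k : nat) (U : set 'rV[R]_n)
    (X : 'I_k -> 'rV[R]_n -> 'rV[R]_n) (s : 'rV[R]_k -> 'rV[R]_n)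
    (M : 'rV[R]_k -> 'M[R]_k) :
  (\forall v \near (0 : 'rV[R]_k),
    [/\ U (s v), M v \in unitmx, {for v, continuous M},
        (forall i, {for s v, continuous (X i)}) &
        has_diff v s (fun w => w *m (M v *m distr_mx X (s v)))]) ->
  integral_manifold_at U X (s 0) s.
Proof.
move=> sX; split=> //.
have JE v : has_diff v s (fun w => w *m (M v *m distr_mx X (s v))) ->
    jacobian s v = M v *m distr_mx X (s v).
  move=> [_ ds]; apply/matrixP => i j.
  by rewrite /jacobian mxE ds -rowE mxE.
near=> v.
have [Usv Mu Mc Xc ds] : [/\ U (s v), M v \in unitmx, {for v, continuous M},
    (forall i, {for s v, continuous (X i)}) &
    has_diff v s (fun w => w *m (M v *m distr_mx X (s v)))].
  by near: v.
split=> //; first by case: ds.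
(* Continuity of the Jacobian at v needs the factorization on a whole neighbourhood of v, hence
   [near_join]. *)
- have JEv : {near v, (fun w => M w *m distr_mx X (s w)) =1 jacobian s}.
    have : \forall w \near v, [/\ U (s w), M w \in unitmx,
        {for w, continuous M}, (forall i, {for s w, continuous (X i)}) &
        has_diff w s (fun z => z *m (M w *m distr_mx X (s w)))].
      by near: v; exact: near_join sX.
    by apply: filterS => w [_ _ _ _ /JE].
  rewrite /prop_for /continuous_at (JE _ ds).
  apply: cvg_trans (near_eq_cvg JEv) _.
  apply: (@continuous_mx _ _ _ _ (fun w => M w *m distr_mx X (s w))) => i j.
  have -> : (fun w => (M w *m distr_mx X (s w)) i j) =
      (fun w => \sum_l M w i l * X l (s w) ord0 j).
    apply/funext => w; rewrite mxE; apply: eq_bigr => l _.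
    by rewrite [distr_mx _ _ _ _]mxE.
  apply: continuous_bigsum => l; apply: continuousM.
    exact: continuous_comp Mc (@coord_continuous _ _ _ _ _ _).
  apply: (@continuous_comp _ _ _ s (fun y => X l y ord0 j)).
    exact: has_diff_continuous ds.
  exact: continuous_comp (Xc l) (@coord_continuous _ _ _ _ _ _).
- by apply/eqmxMunitP; exists (M v); rewrite // JE.
Unshelve. all: by end_near. Qed.

Lemma local_antiderivative (R : realType) (f : R -> R) (x0 : R) :
  (\forall x \near x0, {for x, continuous f}) ->
  exists F : R -> R, \forall x \near x0, is_derive (x : R) (1 : R) F (f x).
Proof.
move=> /nbhs_ballP[e /= e0 fc].
(* Half the radius keeps the closed interval inside the ball where f is continuous; the derivative
   is taken at its interior points. *)
pose a := x0 - e / 2; pose b := x0 + e / 2.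
have inball x : a <= x <= b -> ball x0 e x.
  move=> /andP[ax xb]; rewrite /ball/= ltr_norml /a /b in ax xb *.
  by apply/andP; split; lra.
have fi : lebesgue_measure.-integrable `[a, b] (EFin \o f).
  apply: continuous_compact_integrable; first exact: segment_compact.
  apply: continuous_in_subspaceT => x; rewrite inE/= in_itv/= => axb.
  exact/fc/inball.
exists (fun x => \int[lebesgue_measure]_(t in `[a, x]) f t)%R.
apply/nbhs_ballP; exists (e / 2) => /=; first by lra.
move=> x; rewrite /ball/= ltr_norml => /andP[h1 h2].
have ax : a < x by rewrite /a; lra.
have xb : x < b by rewrite /b; lra.
have cfx : {for x, continuous f} by apply/fc/inball; rewrite !ltW.
have [dF <-] := continuous_FTC1_closed xb fi ax cfx.
by rewrite derive1E; exact: derivableP.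
Qed.

(** One syntax-directed differentiation step, constants first. The differential is left as an
    existential variable, to be reshaped through [has_diff_ext]; a denominator must be known to be
    nonzero in the context in the form in which it occurs. *)
Ltac diff_step := lazymatch goal with
  | |- has_diff _ (fun=> ?c) _ => exact (has_diff_cst c _)
  | |- has_diff _ (fun y => fun_of_matrix y _ ?i) _ =>
      exact (has_diff_coord _ i)
  | |- has_diff _ (fun y => @?f y + @?g y) _ => eapply (@has_diff_add _ _ f g)
  | |- has_diff _ (fun y => - @?f y) _ => eapply (@has_diff_opp _ _ f)
  | |- has_diff _ (fun y => @?f y * @?g y) _ => eapply (@has_diff_mul _ _ f g)
  | |- has_diff _ (fun y => (@?f y)^-1) _ =>
      eapply (@has_diff_inv _ _ f); [by []|]
  | |- has_diff _ (fun y => @?f y ^+ _) _ => eapply (@has_diff_exp _ _ f)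
  end.

(** * The equation and its prolongation for a general A *)

Section ConstrainedFlow.
Context {R : realType} (C2 C3 : R) (A A1 A2 : R -> R) (O : set R).
Hypotheses (O_open : open O) (O_neq0 : forall r, O r -> r != 0).
Hypothesis A_derive : forall r, O r -> is_derive r (1 : R) A (A1 r).
Hypothesis A1_derive : forall r, O r -> is_derive r (1 : R) A1 (A2 r).

Let has_diff_A (V : normedModType R) (f df : V -> R) p :
  O (f p) -> has_diff p f df ->
  has_diff p (fun y => A (f y)) (fun v => A1 (f p) * df v).
Proof. by move=> /A_derive; exact: has_diff_comp. Qed.

Let has_diff_A1 (V : normedModType R) (f df : V -> R) p :
  O (f p) -> has_diff p f df ->
  has_diff p (fun y => A1 (f y)) (fun v => A2 (f p) * df v).
Proof. by move=> /A1_derive; exact: has_diff_comp. Qed.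

(** The system is linear homogeneous in the first derivatives, so on the equation u_x, rho_t and u_t
    are multiples of rho_x; these are the factors. *)
Definition ux_slope (u r : R) := - (u - C2) / (r * (C3 * r - 1)).
Definition rhot_slope (u r : R) := - (u + r * ux_slope u r).
Definition ut_slope (u r : R) := - (u * ux_slope u r + A r).

(* The function f = (u - C2) (C3 - 1 / rho) satisfies
   f_t = invar_rate u rho * rho_x on the equation. *)
Definition invar_rate (u r : R) :=
  (u - C2) ^+ 2 / (r ^+ 2 * (C3 * r - 1)) - A r * (C3 * r - 1) / r.
(* The derivative of invar_rate in rho at constant f, not at constant u. *)
Definition invar_rate_r (u r : R) :=
  - (3 * C3 * (u - C2) ^+ 2 / (r ^+ 2 * (C3 * r - 1) ^+ 2))
  - A1 r * (C3 * r - 1) / r - A r / r ^+ 2.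

(** Since f_x = 0, N depends on x through rho alone; f_xt = (N rho_x)_x = 0 then yields this
    coefficient of rho_x^2 in rho_xx. *)
Definition rhoxx_coef (u r : R) := - invar_rate_r u r / invar_rate u r.
(** This comes from differentiating rho_t = [rhot_slope] rho_x in x; the last term is the derivative
    of [rhot_slope] in rho at constant f. *)
Definition rhotx_coef (u r : R) :=
  rhoxx_coef u r * rhot_slope u r - 2 * (u - C2) / (r * (C3 * r - 1) ^+ 2).

Definition second_order (a : 'rV[R]_8) : 'rV[R]_6 :=
  let u := crd_u a in let r := crd_rho a in let rx := crd_rhox a in
  let ux := ux_slope u r * rx in let rt := rhot_slope u r * rx in
  let ut := ut_slope u r * rx in
  let rxx := rhoxx_coef u r * rx ^+ 2 in let rtx := rhotx_coef u r * rx ^+ 2 in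
  let uxx := rxx * ux_slope u r
    + rx * ((u - C2) * (2 * C3 * r - 1) / (r * (C3 * r - 1)) ^+ 2 * rx
            - ux / (r * (C3 * r - 1))) in
  let utx := - (ux ^+ 2 + u * uxx + A1 r * rx ^+ 2 + A r * rxx) in
  row_of 6
    [:: - (ut * ux + u * utx + A1 r * rt * rx + A r * rtx); utx; uxx;
        - (rtx * u + rx * ut + rt * ux + r * utx); rtx; rxx].

Let al := alpha C3.
Let be := beta C2 C3.

Lemma slopeE u r : al r * u + be r = ux_slope u r.
Proof.
by rewrite /al /be /alpha /beta /ux_slope; set k := (_ * (_ - _))^-1; ring.
Qed.

Lemma system_paramE p : system_param al be A p =
  let u := p ord0 (inord 2) in let r := p ord0 (inord 3) in
  let rx := p ord0 (inord 4) in
  row_of 8 [:: p ord0 (inord 0); p ord0 (inord 1); u; r;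
    ut_slope u r * rx; ux_slope u r * rx; rhot_slope u r * rx; rx].
Proof.
rewrite /system_param /= slopeE /ut_slope /rhot_slope.
by congr (row_of 8 _); congr [:: _, _, _, _, _, _, _ & _]; ring.
Qed.

Lemma row8_eq (a b : 'rV[R]_8) :
  (forall k, (k < 8)%N -> a ord0 (inord k) = b ord0 (inord k)) -> a = b.
Proof. by move=> ab; apply/rowP => i; rewrite -(inord_val i) ab. Qed.

(** The equations are triangular: the constraint gives u_x, after which the other two give u_t and
    rho_t. *)
Lemma equation_setP a : equation_set (system al be A) a <->
  exists p, a = system_param al be A p.
Proof.
split=> [aE|[p ->] i].
  exists (coordE a); rewrite system_paramE /coordE /= !row_ofE//=.
  have := aE (inord 0); have := aE (inord 1); have := aE (inord 2).
  rewrite /system !inordK//= !slopeE => e3 e2 e1.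
  have ux : crd_ux a = ux_slope (crd_u a) (crd_rho a) * crd_rhox a by lra.
  rewrite ux in e2 e1.
  apply: row8_eq; do 8?[case=> [_|]]; rewrite ?row_ofE //=.
  - rewrite -/(crd_ut a) /ut_slope; lra.
  - rewrite -/(crd_rhot a) /rhot_slope; lra.
rewrite system_paramE /system /crd_ut /crd_u /crd_ux /crd_rho /crd_rhox.
rewrite /crd_rhot !row_ofE//= slopeE.
by case: i => -[|[|[|//]]] i /=; rewrite /ut_slope /rhot_slope; ring.
Qed.

Lemma coordEK p : coordE (system_param al be A p) = p.
Proof.
apply/rowP => i; rewrite system_paramE mxE.
rewrite /crd_t /crd_x /crd_u /crd_rho /crd_rhox !row_ofE//=.
by case: i => -[|[|[|[|[|//]]]]] i /=; congr (p _ _); apply/val_inj;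
  rewrite /= inordK.
Qed.

(** The direction v is arbitrary, so that one computation serves for both D_t and D_x. *)
Lemma derive_system (a v : 'rV[R]_8) : O (crd_rho a) -> C3 * crd_rho a != 1 ->
  let u := crd_u a in let r := crd_rho a in let rx := crd_rhox a in
  [/\ 'D_v (system al be A (inord 0)) a =
       crd_ut v + crd_u v * crd_ux a + u * crd_ux v
       + A1 r * crd_rho v * rx + A r * crd_rhox v,
      'D_v (system al be A (inord 1)) a =
       crd_rhot v + crd_rhox v * u + rx * crd_u v + crd_rho v * crd_ux a
       + r * crd_ux v &
      'D_v (system al be A (inord 2)) a =
       crd_ux v - crd_rhox v * ux_slope u r
       - rx * ((u - C2) * (2 * C3 * r - 1) / (r * (C3 * r - 1)) ^+ 2 * crd_rho v
               - crd_u v / (r * (C3 * r - 1)))].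
Proof.
move=> Or qr /=.
have r0 := O_neq0 Or.
have q0 : C3 * crd_rho a - 1 != 0 by rewrite subr_eq0.
have rq0 : crd_rho a * (C3 * crd_rho a - 1) != 0 by rewrite mulf_neq0.
rewrite /system !inordK//= /al /be /alpha /beta.
rewrite /crd_ut /crd_u /crd_ux /crd_rho /crd_rhox /crd_rhot in Or r0 q0 rq0 *.
split.
- apply: etrans; first apply: derive_has_diff; [|].
    by repeat (diff_step || apply: (has_diff_A Or)).
  by rewrite /=; ring.
- apply: etrans; first apply: derive_has_diff; [|].
    by repeat diff_step.
  by rewrite /=; ring.
- apply: etrans; first apply: derive_has_diff; [|].
    by repeat diff_step.
  by rewrite /ux_slope /=; field; rewrite r0 q0.
Qed.

Lemma invar_rate_neq0 u r : O r -> C3 * r != 1 ->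
  (C2 - u) ^+ 2 - r * A r * (C3 * r - 1) ^+ 2 != 0 <-> invar_rate u r != 0.
Proof.
move=> Or qr; have r0 := O_neq0 Or.
have q0 : C3 * r - 1 != 0 by rewrite subr_eq0.
have -> : (C2 - u) ^+ 2 - r * A r * (C3 * r - 1) ^+ 2 =
    invar_rate u r * (r ^+ 2 * (C3 * r - 1)).
  by rewrite /invar_rate; field; rewrite r0 q0.
by rewrite mulf_eq0 (negbTE (mulf_neq0 _ _)) ?orbF// expf_neq0.
Qed.

(** This is f_t = N rho_x, divided by rho_x and multiplied by rho / q. *)
Lemma slope_rate u r : r != 0 -> C3 * r - 1 != 0 ->
  ut_slope u r = r / (C3 * r - 1) * invar_rate u r
                 + ux_slope u r * rhot_slope u r.
Proof.
move=> r0 q0; rewrite /ut_slope /rhot_slope /ux_slope /invar_rate; field.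
by rewrite r0 q0.
Qed.

(** The six equations are linear in the six second derivatives. Five of them express the other
    unknowns through rho_xx; the sixth, D_t of the constraint, becomes a nonzero multiple of N
    rho_xx + N_rho rho_x^2 = 0 and is solvable because N does not vanish. *)
Lemma prolonged_system_solve u r rx utt utx uxx rtt rtx rxx :
  r != 0 -> C3 * r - 1 != 0 -> invar_rate u r != 0 ->
  let ut := ut_slope u r * rx in let ux := ux_slope u r * rx in
  let rt := rhot_slope u r * rx in
  let duxc ru du := (u - C2) * (2 * C3 * r - 1) / (r * (C3 * r - 1)) ^+ 2 * ru
                    - du / (r * (C3 * r - 1)) in
  ([/\ utt + ut * ux + u * utx + A1 r * rt * rx + A r * rtx = 0,
       rtt + rtx * u + rx * ut + rt * ux + r * utx = 0 &
       utx - rtx * ux_slope u r - rx * duxc rt ut = 0] /\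
   [/\ utx + ux * ux + u * uxx + A1 r * rx * rx + A r * rxx = 0,
       rtx + rxx * u + rx * ux + rx * ux + r * uxx = 0 &
       uxx - rxx * ux_slope u r - rx * duxc rx ux = 0]) <->
  [/\ rxx = rhoxx_coef u r * rx ^+ 2, rtx = rhotx_coef u r * rx ^+ 2,
      uxx = rxx * ux_slope u r + rx * duxc rx ux,
      utx = - (ux ^+ 2 + u * uxx + A1 r * rx ^+ 2 + A r * rxx) &
      utt = - (ut * ux + u * utx + A1 r * rt * rx + A r * rtx) /\
      rtt = - (rtx * u + rx * ut + rt * ux + r * utx)].
Proof.
move=> r0 q0 N0 ut ux rt duxc.
have rtxE : rhotx_coef u r * rx ^+ 2 =
    rhot_slope u r * (rhoxx_coef u r * rx ^+ 2)
    - 2 * (u - C2) / (r * (C3 * r - 1) ^+ 2) * rx ^+ 2.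
  by rewrite /rhotx_coef; ring.
(* The continuity equation differentiated in x, with u_xx eliminated by the x-derivative of the
   constraint. *)
have x2E uxx' rxx' : uxx' = rxx' * ux_slope u r + rx * duxc rx ux ->
    - (rxx' * u + rx * ux + rx * ux + r * uxx') =
    rhot_slope u r * rxx' - 2 * (u - C2) / (r * (C3 * r - 1) ^+ 2) * rx ^+ 2.
  move=> ->; rewrite /rhot_slope /duxc /ux /ux_slope; field.
  by rewrite r0 q0.
(* The decisive elimination: D_t of the constraint reduces to (rho / q) f_xt. *)
have t3E uxx' rxx' rtx' utx' : uxx' = rxx' * ux_slope u r + rx * duxc rx ux ->
    rtx' = rhot_slope u r * rxx'
           - 2 * (u - C2) / (r * (C3 * r - 1) ^+ 2) * rx ^+ 2 ->
    utx' = - (ux ^+ 2 + u * uxx' + A1 r * rx ^+ 2 + A r * rxx') ->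
    utx' - rtx' * ux_slope u r - rx * duxc rt ut =
    r / (C3 * r - 1) * (invar_rate u r * rxx' + invar_rate_r u r * rx ^+ 2).
  move=> -> -> ->; rewrite /duxc /rt /ut /ux /ut_slope /rhot_slope /invar_rate.
  rewrite /invar_rate_r /ux_slope; field.
  by rewrite r0 q0.
split.
  move=> [[t1 t2 t3] [x1 x2 x3]].
  have uxxE : uxx = rxx * ux_slope u r + rx * duxc rx ux by lra.
  have utxE : utx = - (ux ^+ 2 + u * uxx + A1 r * rx ^+ 2 + A r * rxx).
    by apply/eqP; rewrite -subr_eq0 opprK -{}x1; apply/eqP; ring.
  have rtxE' : rtx = rhot_slope u r * rxx
      - 2 * (u - C2) / (r * (C3 * r - 1) ^+ 2) * rx ^+ 2.
    rewrite -(x2E uxx)//; apply/eqP; rewrite -subr_eq0 opprK -{}x2.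
    by apply/eqP; ring.
  have rxxE : rxx = rhoxx_coef u r * rx ^+ 2.
    move: t3; rewrite (t3E uxx rxx)// => /eqP.
    rewrite mulf_eq0 (negbTE (mulf_neq0 r0 _)) ?invr_neq0//= => /eqP e.
    rewrite /rhoxx_coef; apply: (mulfI N0).
    by rewrite mulrA [_ * (_ / _)]mulrC divfK//; lra.
  split=> //; first by rewrite rtxE// rtxE' rxxE.
  by split; lra.
move=> [rxxE rtxE1 uxxE utxE [-> ->]].
have rtxE' : rtx = rhot_slope u r * rxx
      - 2 * (u - C2) / (r * (C3 * r - 1) ^+ 2) * rx ^+ 2.
  by rewrite rtxE1 rtxE// rxxE.
split; split; try ring.
- rewrite (t3E uxx rxx)// rxxE /rhoxx_coef.
  by rewrite mulrA (mulrC (invar_rate u r)) divfK//; ring.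
- by rewrite utxE; ring.
- by rewrite rtxE' -(x2E _ _ uxxE); ring.
- by rewrite uxxE; ring.
Qed.

Lemma prolongedP a h : equation_set (system al be A) a ->
  O (crd_rho a) -> C3 * crd_rho a != 1 ->
  invar_rate (crd_u a) (crd_rho a) != 0 ->
  prolonged (system al be A) a h <-> h = second_order a.
Proof.
move=> aE Or qr N0.
have r0 := O_neq0 Or.
have q0 : C3 * crd_rho a - 1 != 0 by rewrite subr_eq0.
have [p ap] := (equation_setP a).1 aE.
have pE k : (k < 5)%N -> p ord0 (inord k) = coordE a ord0 (inord k).
  by rewrite ap coordEK.
have uxE : crd_ux a = ux_slope (crd_u a) (crd_rho a) * crd_rhox a.
  by rewrite {1}ap system_paramE /crd_ux row_ofE//= !pE// !row_ofE.
have utE : crd_ut a = ut_slope (crd_u a) (crd_rho a) * crd_rhox a.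
  by rewrite {1}ap system_paramE /crd_ut row_ofE//= !pE// !row_ofE.
have rtE : crd_rhot a = rhot_slope (crd_u a) (crd_rho a) * crd_rhox a.
  by rewrite {1}ap system_paramE /crd_rhot row_ofE//= !pE// !row_ofE.
have [t1 t2 t3] := derive_system (total_t a h) Or qr.
have [x1 x2 x3] := derive_system (total_x a h) Or qr.
have -> : prolonged (system al be A) a h <->
  [/\ 'D_(total_t a h) (system al be A (inord 0)) a = 0,
      'D_(total_t a h) (system al be A (inord 1)) a = 0 &
      'D_(total_t a h) (system al be A (inord 2)) a = 0] /\
  [/\ 'D_(total_x a h) (system al be A (inord 0)) a = 0,
      'D_(total_x a h) (system al be A (inord 1)) a = 0 &
      'D_(total_x a h) (system al be A (inord 2)) a = 0].
  split=> [P|[[P1 P2 P3] [P4 P5 P6]] i].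
    have [P1 P2] := P (inord 0); have [P3 P4] := P (inord 1).
    by have [P5 P6] := P (inord 2).
  have P k : (k < 3)%N -> 'D_(total_t a h) (system al be A (inord k)) a = 0 /\
      'D_(total_x a h) (system al be A (inord k)) a = 0.
    by case: k => [_|[_|[_|n //]]]; split; assumption.
  by have := P i (ltn_ord i); rewrite inord_val.
rewrite {}t1 {}t2 {}t3 {}x1 {}x2 {}x3.
rewrite /crd_ut /crd_u /crd_ux /crd_rho /crd_rhox /crd_rhot.
rewrite /total_t /total_x !row_ofE//=.
rewrite -/(crd_ut a) -/(crd_u a) -/(crd_ux a) -/(crd_rho a) -/(crd_rhox a).
rewrite -/(crd_rhot a) uxE utE rtE.
rewrite /second_order.
have := prolonged_system_solve (crd_rhox a) (crd_utt h) (crd_utx h) (crd_uxx h)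
  (crd_rhott h) (crd_rhotx h) (crd_rhoxx h) r0 q0 N0.
move=> /= ->.
split=> [[rxxE rtxE uxxE utxE [uttE rttE]]|->]; last first.
  rewrite /crd_utt /crd_utx /crd_uxx /crd_rhott /crd_rhotx /crd_rhoxx.
  by rewrite !row_ofE.
apply/rowP => i; rewrite mxE.
rewrite -[in LHS](inord_val i); case: i => -[|[|[|[|[|[|//]]]]]] i /=.
- by rewrite -/(crd_utt h) uttE utxE uxxE rtxE rxxE.
- by rewrite -/(crd_utx h) utxE uxxE rxxE.
- by rewrite -/(crd_uxx h) uxxE rxxE.
- by rewrite -/(crd_rhott h) rttE utxE uxxE rtxE rxxE.
- by rewrite -/(crd_rhotx h).
- by rewrite -/(crd_rhoxx h).
Qed.

(** * The Cartan distribution: rank and involutivity *)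

Let field_t (p : 'rV[R]_5) :=
  let u := p ord0 (inord 2) in let r := p ord0 (inord 3) in
  let rx := p ord0 (inord 4) in
  row_of 5 [:: 1; 0; ut_slope u r * rx; rhot_slope u r * rx;
               rhotx_coef u r * rx ^+ 2].

Let field_x (p : 'rV[R]_5) :=
  let u := p ord0 (inord 2) in let r := p ord0 (inord 3) in
  let rx := p ord0 (inord 4) in
  row_of 5 [:: 0; 1; ux_slope u r * rx; rx; rhoxx_coef u r * rx ^+ 2].

Let flow := cartan_field (system_param al be A) second_order.

Lemma second_order_rhotx a : crd_rhotx (second_order a) =
  rhotx_coef (crd_u a) (crd_rho a) * crd_rhox a ^+ 2.
Proof. by rewrite /crd_rhotx row_ofE. Qed.

Lemma second_order_rhoxx a : crd_rhoxx (second_order a) =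
  rhoxx_coef (crd_u a) (crd_rho a) * crd_rhox a ^+ 2.
Proof. by rewrite /crd_rhoxx row_ofE. Qed.

(** Of the second derivatives only rho_tx and rho_xx survive the projection to (t, x, u, rho,
    rho_x). *)
Lemma cartan_fieldE i : flow i = if i == ord0 then field_t else field_x.
Proof.
apply/funext => p; rewrite /flow /cartan_field /=.
set a := system_param _ _ _ _.
have aE : a = system_param al be A p by [].
rewrite system_paramE in aE.
have uE : crd_u a = p ord0 (inord 2) by rewrite aE /crd_u row_ofE.
have rE : crd_rho a = p ord0 (inord 3) by rewrite aE /crd_rho row_ofE.
have rxE : crd_rhox a = p ord0 (inord 4) by rewrite aE /crd_rhox row_ofE.
have utE : crd_ut a = ut_slope (crd_u a) (crd_rho a) * crd_rhox a.
  by rewrite uE rE rxE aE /crd_ut row_ofE.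
have uxE : crd_ux a = ux_slope (crd_u a) (crd_rho a) * crd_rhox a.
  by rewrite uE rE rxE aE /crd_ux row_ofE.
have rtE : crd_rhot a = rhot_slope (crd_u a) (crd_rho a) * crd_rhox a.
  by rewrite uE rE rxE aE /crd_rhot row_ofE.
case: ifP => _.
  rewrite /field_t -uE -rE -rxE -second_order_rhotx -utE -rtE.
  by congr (row_of 5 _); congr [:: _; _; _; _; _]; rewrite [LHS]row_ofE.
rewrite /field_x -uE -rE -rxE -second_order_rhoxx -uxE.
by congr (row_of 5 _); congr [:: _; _; _; _; _]; rewrite [LHS]row_ofE.
Qed.

(** The t and x components of the two fields form an identity block, which [E] extracts. *)
Lemma rank_flow p : \rank (distr_mx flow p) = 2.
Proof.
apply/eqP; rewrite eqn_leq rank_leq_row /=.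
pose E : 'M[R]_(5, 2) := \matrix_(i, j) (i == j :> nat)%:R.
have dE (i j : 'I_2) : distr_mx flow p i (inord j) = (i == j)%:R.
  rewrite mxE cartan_fieldE.
  by case: i => -[|[|//]] i; case: j => -[|[|//]] j; rewrite [LHS]mxE inordK.
suff <- : \rank (distr_mx flow p *m E) = 2 by exact: mxrankM_maxl.
rewrite (_ : _ *m _ = 1%:M) ?mxrank1//; apply/matrixP => i j.
have j5 : (j < 5)%N by rewrite (leq_trans (ltn_ord j)).
rewrite mxE (bigD1 (inord j)) //= dE [E _ _]mxE inordK// eqxx mulr1.
rewrite big1 => [|k kj]; first by rewrite addr0 mxE.
rewrite [E _ _]mxE; case: eqP => [e|_]; last by rewrite mulr0.
by case/eqP: kj; apply/val_inj; rewrite /= inordK ?e.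
Qed.

Lemma has_diff_ux_slope (V : normedModType R) (f g df dg : V -> R) p :
  g p * (C3 * g p - 1) != 0 -> has_diff p f df -> has_diff p g dg ->
  has_diff p (fun y => ux_slope (f y) (g y))
    (fun v => - df v / (g p * (C3 * g p - 1))
     + (f p - C2) * (2 * C3 * g p - 1) / (g p * (C3 * g p - 1)) ^+ 2 * dg v).
Proof.
move=> rq fdf gdg; have := rq; rewrite mulf_eq0 negb_or => /andP[r0 q0].
apply: has_diff_ext.
  by rewrite /ux_slope; repeat (diff_step || exact: fdf || exact: gdg).
by move=> v /=; field; rewrite r0 q0.
Qed.

(** The bracket involves the u-derivative [Qu] only through its product with N, whereas the terms in
    [Qr] cancel; hence the form of the conclusion. *)
Lemma has_diff_rhoxx_coef (p : 'rV[R]_5) :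
  let u := p ord0 (inord 2) in let r := p ord0 (inord 3) in
  O r -> C3 * r - 1 != 0 -> invar_rate u r != 0 ->
  exists Qu Qr : R,
    Qu * invar_rate u r = 6 * C3 * (u - C2) / (r ^+ 2 * (C3 * r - 1) ^+ 2)
      - rhoxx_coef u r * (2 * (u - C2) / (r ^+ 2 * (C3 * r - 1))) /\
    has_diff p (fun y => rhoxx_coef (y ord0 (inord 2)) (y ord0 (inord 3)))
      (fun v => Qu * v ord0 (inord 2) + Qr * v ord0 (inord 3)).
Proof.
move=> u r Or q0 N0; have r0 := O_neq0 Or.
have rq1 : r ^+ 2 * (C3 * r - 1) != 0 by rewrite mulf_neq0 ?expf_neq0.
have rq2 : r ^+ 2 * (C3 * r - 1) ^+ 2 != 0 by rewrite mulf_neq0 ?expf_neq0.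
have r2 : r ^+ 2 != 0 by rewrite expf_neq0.
set Nu := 2 * (u - C2) / (r ^+ 2 * (C3 * r - 1)).
pose Nr := - (u - C2) ^+ 2 * (2 * r * (C3 * r - 1) + r ^+ 2 * C3)
    / (r ^+ 2 * (C3 * r - 1)) ^+ 2 - A1 r * (C3 * r - 1) / r - A r / r ^+ 2.
have dN : has_diff p (fun y => invar_rate (y ord0 (inord 2)) (y ord0 (inord 3)))
    (fun v => Nu * v ord0 (inord 2) + Nr * v ord0 (inord 3)).
  apply: has_diff_ext.
    by rewrite /invar_rate; repeat (diff_step || apply: (has_diff_A Or)).
  by move=> v; rewrite /= -/u -/r /Nu /Nr; field; rewrite r0 q0.
set Mu := 6 * C3 * (u - C2) / (r ^+ 2 * (C3 * r - 1) ^+ 2).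
pose Mr := 3 * C3 * (u - C2) ^+ 2
    * (2 * r * (C3 * r - 1) ^+ 2 + 2 * r ^+ 2 * C3 * (C3 * r - 1))
    / (r ^+ 2 * (C3 * r - 1) ^+ 2) ^+ 2
  - A2 r * (C3 * r - 1) / r - 2 * A1 r / r ^+ 2 + 2 * A r / r ^+ 3.
have dM : has_diff p
    (fun y => invar_rate_r (y ord0 (inord 2)) (y ord0 (inord 3)))
    (fun v => - Mu * v ord0 (inord 2) + Mr * v ord0 (inord 3)).
  apply: has_diff_ext.
    rewrite /invar_rate_r.
    by repeat (diff_step || apply: (has_diff_A Or) || apply: (has_diff_A1 Or)).
  by move=> v; rewrite /= -/u -/r /Mu /Mr; field; rewrite r0 q0.
exists ((Mu - rhoxx_coef u r * Nu) / invar_rate u r).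
exists (- (Mr + rhoxx_coef u r * Nr) / invar_rate u r).
split; first by rewrite divfK.
apply: has_diff_ext.
  by rewrite /rhoxx_coef; repeat (diff_step || exact: dN || exact: dM).
by move=> v; rewrite /= -/u -/r /rhoxx_coef; field.
Qed.

(** The t and x components are constant, so the bracket can lie in the distribution only by
    vanishing. Its u component vanishes by the equation that determined rho_xx, its rho component by
    the choice of rho_tx; the rho_x component, D_t rho_xx = D_x rho_tx, is the genuine integrability
    condition. *)
Lemma flow_involutive (p : 'rV[R]_5) :
  let u := p ord0 (inord 2) in let r := p ord0 (inord 3) in
  O r -> C3 * r - 1 != 0 -> invar_rate u r != 0 ->
  [/\ differentiable field_t p, differentiable field_x p &
      lie_bracket field_t field_x p = 0].
Proof.
move=> u r Or q0 N0; have r0 := O_neq0 Or.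
pose rx := p ord0 (inord 4).
have rq : r * (C3 * r - 1) != 0 by rewrite mulf_neq0.
have rq2 : r * (C3 * r - 1) ^+ 2 != 0 by rewrite mulf_neq0 ?expf_neq0.
have [Qu [Qr [QuN dQ]]] := has_diff_rhoxx_coef Or q0 N0.
rewrite -/u -/r in QuN.
have du := has_diff_ux_slope rq (has_diff_coord p (inord 2))
  (has_diff_coord p (inord 3)).
rewrite -/u -/r in du.
set T := ux_slope u r; set Q := rhoxx_coef u r.
set T3 := rhot_slope u r; set T1 := ut_slope u r.
pose dT (v : 'rV[R]_5) := - v ord0 (inord 2) / (r * (C3 * r - 1))
  + (u - C2) * (2 * C3 * r - 1) / (r * (C3 * r - 1)) ^+ 2 * v ord0 (inord 3).
pose dT1 (v : 'rV[R]_5) :=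
  - (v ord0 (inord 2) * T + u * dT v + A1 r * v ord0 (inord 3)).
pose dT3 (v : 'rV[R]_5) :=
  - (v ord0 (inord 2) + v ord0 (inord 3) * T + r * dT v).
pose dB (v : 'rV[R]_5) :=
  (Qu * v ord0 (inord 2) + Qr * v ord0 (inord 3)) * T3 + Q * dT3 v
  - 2 * v ord0 (inord 2) / (r * (C3 * r - 1) ^+ 2)
  + 2 * (u - C2) * (C3 * r - 1 + 2 * C3 * r) / (r ^+ 2 * (C3 * r - 1) ^+ 3)
    * v ord0 (inord 3).
have dt : has_diff p field_t (fun v => row_of 5 [:: 0; 0;
    dT1 v * rx + T1 * v ord0 (inord 4); dT3 v * rx + T3 * v ord0 (inord 4);
    dB v * rx ^+ 2 + rhotx_coef u r * (2 * rx * v ord0 (inord 4))]).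
  apply: has_diff_row_of5; apply: has_diff_ext.
  all: rewrite ?/rhotx_coef ?/ut_slope ?/rhot_slope.
  all: try by repeat (diff_step || exact: du || exact: dQ
                      || apply: (has_diff_A Or)).
  all: try by [].
  - by move=> v; rewrite /= -/u -/r -/rx -/T /dT1 /dT /T1 /ut_slope -/T; ring.
  - by move=> v; rewrite /= -/u -/r -/rx -/T /dT3 /dT /T3 /rhot_slope -/T; ring.
  - move=> v; rewrite /= -/u -/r -/rx -/T -/Q /dB /dT3 /dT /T3 /rhot_slope -/T.
    by field; rewrite r0 q0.
have dx : has_diff p field_x (fun v => row_of 5 [:: 0; 0;
    dT v * rx + T * v ord0 (inord 4); v ord0 (inord 4);
    (Qu * v ord0 (inord 2) + Qr * v ord0 (inord 3)) * rx ^+ 2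
    + Q * (2 * rx * v ord0 (inord 4))]).
  apply: has_diff_row_of5; apply: has_diff_ext.
  all: try by repeat (diff_step || exact: du || exact: dQ).
  all: try by [].
  - by move=> v; rewrite /= -/u -/r -/rx -/T /dT; ring.
  - by move=> v; rewrite /= -/u -/r -/rx -/Q; ring.
split; [by case: dt | by case: dx |].
rewrite /lie_bracket (derive_has_diff _ dt) (derive_has_diff _ dx).
rewrite /dB /dT1 /dT3 /dT /field_t /field_x -/u -/r -/rx -/T -/T1 -/T3 -/Q.
rewrite !row_ofE//=.
(* This multiple of N clears the denominator of [Q] in the u component; in the rho_x component it
   turns [Qu] into [Qu] times N, after which the multiples of [Q] cancel. *)
have TE : T1 - T * T3 = r / (C3 * r - 1) * invar_rate u r.
  by rewrite /T1 slope_rate// addrK.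
have QuE : Qu * (T1 - T * T3) = r / (C3 * r - 1) *
    (6 * C3 * (u - C2) / (r ^+ 2 * (C3 * r - 1) ^+ 2)
     - Q * (2 * (u - C2) / (r ^+ 2 * (C3 * r - 1)))).
  by rewrite TE mulrCA QuN.
apply/rowP => i; rewrite !mxE.
have QE : Q * (T1 - T * T3) = - (r / (C3 * r - 1) * invar_rate_r u r).
  by rewrite TE mulrCA /Q /rhoxx_coef divfK// mulrN.
case: i => -[|[|[|[|[|//]]]]] i /=; [by rewrite subrr | by rewrite subrr | | |].
- rewrite /rhotx_coef -/T3 -/Q.
  transitivity (rx ^+ 2 * (- (T1 / (r * (C3 * r - 1)))
    + (u - C2) * (2 * C3 * r - 1) / (r * (C3 * r - 1)) ^+ 2 * T3
    - T * (2 * (u - C2) / (r * (C3 * r - 1) ^+ 2))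
    + (T * T + u * (- T / (r * (C3 * r - 1))
       + (u - C2) * (2 * C3 * r - 1) / (r * (C3 * r - 1)) ^+ 2) + A1 r)
    - Q * (T1 - T * T3))); first by ring.
  rewrite QE /T1 /T3 /T /ut_slope /rhot_slope /ux_slope /invar_rate_r; field.
  by rewrite r0 q0.
- rewrite /rhotx_coef -/T3 -/Q /T /ux_slope; field.
  by rewrite r0 q0.
- transitivity (rx ^+ 3 * (Qu * (T1 - T * T3) + Q * (2 * T +
    r * (- T / (r * (C3 * r - 1))
       + (u - C2) * (2 * C3 * r - 1) / (r * (C3 * r - 1)) ^+ 2))
    + 2 * T / (r * (C3 * r - 1) ^+ 2)
    - 2 * (u - C2) * (C3 * r - 1 + 2 * C3 * r)
      / (r ^+ 2 * (C3 * r - 1) ^+ 3))); first by ring.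
  rewrite QuE /T /ux_slope; field.
  by rewrite r0 q0.
Qed.

(** * Explicit integral manifolds *)

Let regular : set 'rV[R]_5 := [set p | let u := p ord0 (inord 2) in
  let r := p ord0 (inord 3) in
  [/\ O r, C3 * r - 1 != 0 & invar_rate u r != 0]].

Let frame (a b c d : R) : 'M[R]_2 :=
  \matrix_i row_of 2 (if i == ord0 then [:: a; b] else [:: c; d]).

Lemma frame_mul a b c d p (w : 'rV[R]_2) :
  w *m (frame a b c d *m distr_mx flow p) =
  (w ord0 (inord 0) * a + w ord0 (inord 1) * c) *: field_t p +
  (w ord0 (inord 0) * b + w ord0 (inord 1) * d) *: field_x p.
Proof.
have i0 : inord 0 = ord0 :> 'I_2 by apply/val_inj; rewrite /= inordK.
have i1 : inord 1 = lift ord0 ord0 :> 'I_2 by apply/val_inj; rewrite /= inordK.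
rewrite i0 i1 mulmxA mulmx_sum_row big_ord_recl big_ord1 !rowK.
rewrite !cartan_fieldE /=.
by rewrite !mxE !big_ord_recl !big_ord0 !mxE /= !addr0.
Qed.

Lemma frame_unit a b d : a != 0 -> d != 0 -> frame a b 0 d \in unitmx.
Proof.
move=> a0 d0; rewrite unitmxE -det_tr det_trig; last first.
  apply/is_trig_mxP => i j ij; rewrite !mxE.
  by case: i ij => -[|[|//]] i; case: j => -[|[|//]] j.
by rewrite big_ord_recl big_ord1 !mxE /= unitfE mulf_neq0.
Qed.

Lemma frame_continuous (T : topologicalType) (a b c d : T -> R) x :
  {for x, continuous a} -> {for x, continuous b} -> {for x, continuous c} ->
  {for x, continuous d} ->
  {for x, continuous (fun y => frame (a y) (b y) (c y) (d y))}.
Proof.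
move=> ac bc cc dc; apply: continuous_mx => i j.
have -> : (fun y => frame (a y) (b y) (c y) (d y) i j) =
    (fun y => (if i == ord0 then [:: a y; b y] else [:: c y; d y])`_j).
  by apply/funext => y; rewrite !mxE.
case: i => -[|[|//]] i; case: j => -[|[|//]] j;
  [exact: ac | exact: bc | exact: cc | exact: dc].
Qed.

Lemma flow_continuous p i : regular p -> {for p, continuous (flow i)}.
Proof.
case=> Or q0 N0; have [dt dx _] := flow_involutive Or q0 N0.
by rewrite cartan_fieldE; case: ifP => _; exact: differentiable_continuous.
Qed.

Lemma integral_manifold_const p : regular p -> p ord0 (inord 4) = 0 ->
  exists s, integral_manifold_at regular flow p s.
Proof.
move=> regp rx0.
pose s (v : 'rV[R]_2) := row_of 5 [:: p ord0 (inord 0) + v ord0 (inord 0);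
  p ord0 (inord 1) + v ord0 (inord 1); p ord0 (inord 2); p ord0 (inord 3); 0].
have regs v : regular (s v) by rewrite /regular/= !row_ofE.
have s0 : s 0 = p.
  apply/rowP => i; rewrite -[in RHS](inord_val i) mxE.
  by case: i => -[|[|[|[|[|//]]]]] i; rewrite /= ?mxE ?addr0.
exists s; rewrite -{1}s0.
apply: (@integral_manifold_frame _ _ _ _ _ _ (fun=> frame 1 0 0 1)).
near=> v; split.
- exact: regs.
- by rewrite frame_unit ?oner_neq0.
- exact: cst_continuous.
- by move=> i; exact: flow_continuous.
apply: has_diff_ext.
  by apply: has_diff_row_of5; repeat diff_step.
move=> w /=; rewrite frame_mul /field_t /field_x !row_ofE//=.
apply/rowP => i; rewrite !mxE.
by case: i => -[|[|[|[|[|//]]]]] i /=; ring.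
Unshelve. all: by end_near. Qed.

(** With rho as a coordinate in place of x, the manifold is the graph of x(t, rho), whose partial
    derivatives must be - rho_t / rho_x in t and 1 / rho_x in rho. *)
Lemma integral_manifold_nonconst p : regular p -> p ord0 (inord 4) != 0 ->
  exists s, integral_manifold_at regular flow p s.
Proof.
set u0 := p ord0 (inord 2); set r0 := p ord0 (inord 3).
set rx0 := p ord0 (inord 4) => -[/= Or q0 N0] rx0_neq0.
have r0_neq0 := O_neq0 Or.
have [P dP] : exists P : R -> R, \forall r \near r0,
    is_derive (r : R) (1 : R) P (A r * (C3 * r - 1) / r).
  apply: local_antiderivative; apply: filterS (open_nbhs_nbhs (conj O_open Or)).
  move=> r Or'; have r_neq0 := O_neq0 Or'.
  have dA := has_diff_A (f := id) (p := r) (df := id) Or' (is_diff_id r).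
  apply: (has_diff_continuous (df := fun v => _)).
  apply: has_diff_mul; last by apply: has_diff_inv => //; exact: (is_diff_id r).
  apply: has_diff_mul; first exact: dA.
  apply: has_diff_add; last exact: has_diff_cst.
  apply: has_diff_mul; first exact: has_diff_cst.
  exact: (is_diff_id r).
(* The value of f_t = N rho_x at p, kept along the manifold; [v] holds the increments of t and
   rho. *)
pose a := rx0 * invar_rate u0 r0.
have a0 : a != 0 by rewrite mulf_neq0.
pose f0 := (u0 - C2) * (C3 * r0 - 1) / r0.
pose rr (v : 'rV[R]_2) := r0 + v ord0 (inord 1).
pose ff (v : 'rV[R]_2) := f0 + a * v ord0 (inord 0).
pose qq v := C3 * rr v - 1.
pose uu v := C2 + ff v * rr v / qq v.
(* N in terms of f and rho, so that rho_x = [a / rate]. *)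
pose rate v := ff v ^+ 2 / qq v ^+ 3 - A (rr v) * qq v / rr v.
(* H is defined by - [rhot_slope] = C2 + f H(rho), and H' = 2 / q^3. The mixed partial derivatives
   of x, in t of [rate / a] and in rho of C2 + f H, therefore both equal 2 f / q^3. *)
pose H r := (C3 * r ^+ 2 - 2 * r) / (C3 * r - 1) ^+ 2.
(* The potential of that closed form: f^2 H / 2 integrates the term f^2 / q^3 of [rate], and P
   integrates the term with A. *)
pose xx (v : 'rV[R]_2) := p ord0 (inord 1) + C2 * v ord0 (inord 0)
  + ((ff v ^+ 2 * H (rr v) - f0 ^+ 2 * H r0) / 2 - (P (rr v) - P r0)) / a.
pose s (v : 'rV[R]_2) := row_of 5 [:: p ord0 (inord 0) + v ord0 (inord 0);
  xx v; uu v; rr v; a / rate v].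
have rr0 : rr 0 = r0 by rewrite /rr mxE addr0.
have ff0 : ff 0 = f0 by rewrite /ff mxE mulr0 addr0.
have uu0 : uu 0 = u0.
  by rewrite /uu /qq rr0 ff0 /f0; field; rewrite r0_neq0 q0.
have rateE v : rr v != 0 -> qq v != 0 -> rate v = invar_rate (uu v) (rr v).
  move=> rn0 qn0; rewrite /rate /invar_rate -/(qq v) /uu; field.
  by rewrite rn0 qn0.
have rate0 : rate 0 = invar_rate u0 r0.
  by rewrite rateE ?uu0 ?rr0// /qq rr0.
have s0 : s 0 = p.
  have xx0 : xx 0 = p ord0 (inord 1).
    by rewrite /xx ff0 rr0 mxE !subrr mul0r !subrr mul0r mulr0 !addr0.
  apply/rowP => i; rewrite -[in RHS](inord_val i) mxE.
  case: i => -[|[|[|[|[|//]]]]] i /=.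
  - by rewrite mxE addr0.
  - exact: xx0.
  - exact: uu0.
  - exact: rr0.
  - by rewrite rate0 /a mulfK.
have drr v : has_diff v rr (fun w => w ord0 (inord 1)).
  apply: has_diff_ext; first by rewrite /rr; repeat diff_step.
  by move=> w; rewrite add0r.
have dff v : has_diff v ff (fun w => a * w ord0 (inord 0)).
  apply: has_diff_ext; [rewrite /ff; repeat diff_step|move=> w /=].
  by rewrite add0r mul0r addr0.
have dqq v : has_diff v qq (fun w => C3 * w ord0 (inord 1)).
  apply: has_diff_ext; first by rewrite /qq; repeat (exact: drr || diff_step).
  by move=> w /=; ring.
have drate v : O (rr v) -> qq v != 0 ->
    has_diff v rate (fun w => 2 * ff v / qq v ^+ 3 * (a * w ord0 (inord 0))
      + invar_rate_r (uu v) (rr v) * w ord0 (inord 1)).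
  move=> Orv qn0; have rn0 := O_neq0 Orv.
  have q3 : qq v ^+ 3 != 0 by rewrite expf_neq0.
  apply: has_diff_ext.
    rewrite /rate; repeat (exact: drr || exact: dff || exact: dqq ||
               apply: (has_diff_A Orv) || diff_step).
  move=> w /=; rewrite /invar_rate_r -/(qq v) /uu /qq; field.
  by rewrite rn0 -/(qq v) qn0.
pose xt v := C2 + ff v * H (rr v).
have dH v : qq v != 0 ->
    has_diff v (fun y => H (rr y)) (fun w => 2 / qq v ^+ 3 * w ord0 (inord 1)).
  move=> qn0; have q2 : (C3 * rr v - 1) ^+ 2 != 0 by rewrite expf_neq0.
  apply: has_diff_ext; first by rewrite /H; repeat (exact: drr || diff_step).
  by move=> w /=; rewrite /qq; field.
have dxt v : qq v != 0 -> has_diff v xt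
    (fun w => a * w ord0 (inord 0) * H (rr v)
      + ff v * (2 / qq v ^+ 3 * w ord0 (inord 1))).
  move=> qn0; apply: has_diff_ext.
    by rewrite /xt; repeat (exact: dff || exact: dH || diff_step).
  by move=> w /=; ring.
have dxx v : qq v != 0 ->
    is_derive (rr v) (1 : R) P (A (rr v) * (C3 * rr v - 1) / rr v) ->
    has_diff v xx (fun w => xt v * w ord0 (inord 0)
                            + rate v / a * w ord0 (inord 1)).
  move=> qn0 dPv; apply: has_diff_ext.
    rewrite /xx; repeat (exact: dff || exact: dH
      || exact: (has_diff_comp dPv (drr v)) || diff_step).
  move=> w /=; rewrite /xt /rate -/(qq v).
  by move: (H (rr v)) (_ / rr v) => h z; field; rewrite a0 qn0.
have good : \forall v \near (0 : 'rV[R]_2), [/\ O (rr v), qq v != 0,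
    rate v != 0 &
    is_derive (rr v) (1 : R) P (A (rr v) * (C3 * rr v - 1) / rr v)].
  have rr_cvg : rr v @[v --> (0 : 'rV[R]_2)] --> r0.
    by rewrite -rr0; exact: has_diff_continuous (drr 0).
  have qq_cvg := has_diff_continuous (dqq 0).
  have qq00 : qq 0 != 0 by rewrite /qq rr0.
  have rate_cvg : {for 0, continuous rate}.
    by apply: has_diff_continuous (drate _ _ qq00); rewrite rr0.
  near=> v; split; near: v.
  - exact: (rr_cvg _ (open_nbhs_nbhs (conj O_open Or))).
  - exact: cvgr_neq0 qq_cvg qq00.
  - by apply: cvgr_neq0 rate_cvg _; rewrite rate0.
  - exact: (rr_cvg _ dP).
exists s; rewrite -{1}s0.
(* At fixed rho the tangent vector is D_t + [xt] D_x; at fixed t it is (1 / rho_x) D_x. These are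
   the rows of the frame. *)
apply: (@integral_manifold_frame _ _ _ _ _ _
  (fun v => frame 1 (xt v) 0 (rate v / a))).
near=> v.
have [Orv qn0 rate_neq0 dPv] : [/\ O (rr v), qq v != 0, rate v != 0 &
    is_derive (rr v) (1 : R) P (A (rr v) * (C3 * rr v - 1) / rr v)].
  by near: v.
have rn0 := O_neq0 Orv.
have su : s v ord0 (inord 2) = uu v by rewrite /s row_ofE.
have sr : s v ord0 (inord 3) = rr v by rewrite /s row_ofE.
have srx : s v ord0 (inord 4) = a / rate v by rewrite /s row_ofE.
have regs : regular (s v).
  by rewrite /regular/= su sr; split=> //; rewrite -rateE.
split.
- exact: regs.
- by rewrite frame_unit ?oner_neq0// mulf_neq0 ?invr_neq0.
- apply: frame_continuous; [exact: cst_continuous| |exact: cst_continuous|].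
    exact: has_diff_continuous (dxt _ qn0).
  apply: has_diff_continuous; apply: has_diff_mul; first exact: drate.
  exact: has_diff_cst.
- by move=> i; exact: flow_continuous.
have duu : has_diff v uu (fun w => a * rr v / qq v * w ord0 (inord 0)
    - ff v / qq v ^+ 2 * w ord0 (inord 1)).
  apply: has_diff_ext.
    rewrite /uu; repeat (exact: drr || exact: dff || exact: dqq || diff_step).
  by move=> w /=; rewrite /qq; field.
have ds : has_diff v s (fun w => row_of 5 [:: w ord0 (inord 0);
    xt v * w ord0 (inord 0) + rate v / a * w ord0 (inord 1);
    a * rr v / qq v * w ord0 (inord 0) - ff v / qq v ^+ 2 * w ord0 (inord 1);
    w ord0 (inord 1);
    - a / rate v ^+ 2 * (2 * ff v / qq v ^+ 3 * (a * w ord0 (inord 0))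
      + invar_rate_r (uu v) (rr v) * w ord0 (inord 1))]).
  apply: has_diff_row_of5; [|exact: dxx|exact: duu|exact: drr|].
    by apply: has_diff_ext; [repeat diff_step|move=> w; rewrite add0r].
  apply: has_diff_ext.
    repeat (apply: drate => // || diff_step).
  by move=> w /=; ring.
apply: has_diff_ext ds _ => w.
rewrite frame_mul /field_t /field_x su sr srx.
have T3E : rhot_slope (uu v) (rr v) = - xt v.
  rewrite /rhot_slope /ux_slope -/(qq v) /xt /H -/(qq v) /uu /qq; field.
  by rewrite rn0 -/(qq v) qn0.
have T2E : ux_slope (uu v) (rr v) = - (ff v / qq v ^+ 2).
  by rewrite /ux_slope -/(qq v) /uu; field; rewrite rn0 qn0.
(* Once everything is expressed by f, rho, q and [rate], with N_rho generalized to [m], only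
   rational identities remain. *)
rewrite slope_rate// -rateE// T3E T2E /rhotx_coef T3E /rhoxx_coef -rateE//.
rewrite -/(qq v).
apply/rowP => i; rewrite !mxE.
have wE : uu v - C2 = ff v * rr v / qq v by rewrite /uu; ring.
rewrite wE; move: (invar_rate_r _ _) => m.
case: i => -[|[|[|[|[|//]]]]] i /=; [by ring|by ring| | |].
- by field; rewrite a0 rate_neq0 qn0.
- by field; rewrite a0 rate_neq0.
- by field; rewrite a0 rate_neq0 qn0 rn0.
Unshelve. all: by end_near. Qed.

Lemma compatible_constrained_flow :
  compatible_on (system al be A) (system_param al be A)
    [set a | let u := crd_u a in let r := crd_rho a in
      [/\ O r, C3 * r != 1 &
          (C2 - u) ^+ 2 - r * A r * (C3 * r - 1) ^+ 2 != 0]].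
Proof.
set W := [set a | _].
have WE : [set p | W (system_param al be A p)] = regular.
  apply/seteqP; split=> p; rewrite /regular /W /= system_paramE /=;
    rewrite /crd_u /crd_rho !row_ofE//= [_ - 1 == 0]subr_eq0 => -[Or qr D0];
    split=> //; exact/(invar_rate_neq0 _ Or qr).
split; [exact: equation_setP | exact: coordEK |].
exists second_order; split=> [a aE [Or qr D0] h|].
  by apply: prolongedP => //; exact/(invar_rate_neq0 _ Or qr).
rewrite WE -/flow; split=> [p _|p [Or q0 N0]|p regp].
- exact: rank_flow.
- have [dt dx br] := flow_involutive Or q0 N0.
  split=> [i|i j]; rewrite !cartan_fieldE; first by case: ifP.
  have -> : lie_bracket (if i == ord0 then field_t else field_x)
      (if j == ord0 then field_t else field_x) p = 0.
    case: ifP => _; case: ifP => _;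
      [exact: subrr | exact: br | | exact: subrr].
    rewrite /lie_bracket -opprB -[X in - X]/(lie_bracket field_t field_x p).
    by rewrite br oppr0.
  exact: sub0mx.
- have [rx0|rx0] := eqVneq (p ord0 (inord 4)) 0.
    exact: integral_manifold_const.
  exact: integral_manifold_nonconst.
Qed.

End ConstrainedFlow.

(** * The pressure law A(rho) and its derivatives *)

Section PressureLaw.
Context {R : realType} (C1 C3 C5 C6 C7 : R).

(** On this set the base of the real power is positive, so the power is differentiable; C3 rho = 1
    is excluded separately. *)
Let O : set R := [set r | 0 < r /\ 0 < C3 + C7 / r].

Lemma pressure_domain_open : open O.
Proof.
rewrite openE => r [r0 g0]; rewrite /interior.
have gc : {for r, continuous (fun s : R => C3 + C7 / s : R)}.
  apply: has_diff_continuous; apply: has_diff_add; first exact: has_diff_cst.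
  apply: has_diff_mul; first exact: has_diff_cst.
  by apply: has_diff_inv (is_diff_id r); rewrite gt_eqF.
near=> s; split; near: s.
- exact: lt_nbhsr.
- exact: cvgr_gt gc _ g0.
Unshelve. all: by end_near. Qed.

Definition Afun_derive (r : R) :=
  - 3 * C5 / r ^+ 4 * (C3 + C7 / r) `^ C6
  - C5 * C6 * C7 / r ^+ 5 * (C3 + C7 / r) `^ (C6 - 1).

Lemma has_diff_powR_arg (r c : R) : O r ->
  has_diff r (fun s => (C3 + C7 / s) `^ c)
    (fun v => - c * C7 / r ^+ 2 * (C3 + C7 / r) `^ (c - 1) * v).
Proof.
move=> [r0 g0]; have rn0 : r != 0 by rewrite gt_eqF.
have dg : has_diff r (fun s => C3 + C7 / s) (fun v => - C7 / r ^+ 2 * v).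
  apply: has_diff_ext.
    apply: has_diff_add; first exact: has_diff_cst.
    apply: has_diff_mul; first exact: has_diff_cst.
    by apply: has_diff_inv (is_diff_id r).
  by move=> v /=; field.
have dp := @has_diff_comp _ _ (fun s : R => C3 + C7 / s) _ r _ _
  (is_derive1_powR c g0) dg.
apply: (has_diff_ext dp) => v.
by move: (_ `^ (c - 1)) => z; field.
Qed.

Lemma is_derive_Afun r : O r ->
  is_derive r (1 : R) (Afun C1 C3 C5 C6 C7) (Afun_derive r).
Proof.
move=> Or; have rn0 : r != 0 by case: Or => r0 _; rewrite gt_eqF.
have r3 : r ^+ 3 != 0 by rewrite expf_neq0.
have dA : has_diff r (Afun C1 C3 C5 C6 C7) (fun v => Afun_derive r * v).
  apply: has_diff_ext.
    rewrite /Afun; apply: has_diff_add; first exact: has_diff_cst.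
    apply: has_diff_mul (has_diff_powR_arg C6 Or).
    apply: has_diff_mul; first exact: has_diff_cst.
    apply: has_diff_inv; first exact: r3.
    by apply: has_diff_exp; exact: (is_diff_id r).
  move=> v /=; rewrite /Afun_derive.
  by move: (_ `^ C6) (_ `^ (C6 - 1)) => y z; field.
rewrite -[Afun_derive r]mulr1 -(derive_has_diff (1 : R) dA).
by apply/derivableP/diff_derivable; case: dA.
Qed.

Lemma derivable_Afun_derive r : O r -> derivable Afun_derive r 1.
Proof.
move=> Or; have rn0 : r != 0 by case: Or => r0 _; rewrite gt_eqF.
have Xn n : has_diff r (fun s : R => (s ^+ n.+1)^-1)
    (fun v => - (r ^+ n.+1)^-2 * (n.+1%:R * r ^+ n * v)).
  apply: has_diff_inv; first by rewrite expf_neq0.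
  by apply: has_diff_exp; exact: (is_diff_id r).
have [df [dA _]] : exists df, has_diff r Afun_derive df.
  eexists; rewrite /Afun_derive.
  apply: has_diff_add; [|apply: has_diff_opp].
    apply: has_diff_mul (has_diff_powR_arg C6 Or).
    by apply: has_diff_mul (Xn 3%N); exact: has_diff_cst.
  apply: has_diff_mul (has_diff_powR_arg (C6 - 1) Or).
  by apply: has_diff_mul (Xn 4%N); exact: has_diff_cst.
exact: diff_derivable.
Qed.

End PressureLaw.

Theorem theorem5 (R : realType) (C1 C2 C3 C5 C6 C7 : R) :
  let al := alpha C3 in
  let be := beta C2 C3 in
  let A := Afun C1 C3 C5 C6 C7 in
  compatible_on (system al be A) (system_param al be A)
    (regular_part C1 C2 C3 C5 C6 C7).
Proof.
move=> al be A.
have -> : regular_part C1 C2 C3 C5 C6 C7 =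
    [set a | let u := crd_u a in let r := crd_rho a in
      [/\ 0 < r /\ 0 < C3 + C7 / r, C3 * r != 1 &
          (C2 - u) ^+ 2 - r * A r * (C3 * r - 1) ^+ 2 != 0]].
  by apply/seteqP; split=> a; [case=> ? ? ? ?; split|case=> -[? ?] ? ?; split].
(* The second derivative of A is supplied unevaluated: its value enters only [Qr], which cancels in
   the bracket. *)
apply: (@compatible_constrained_flow R C2 C3 A (Afun_derive C3 C5 C6 C7)
  (fun r => 'D_1 (Afun_derive C3 C5 C6 C7) r)
  [set r | 0 < r /\ 0 < C3 + C7 / r]).
- exact: pressure_domain_open.
- by move=> r [r0 _]; rewrite gt_eqF.
- exact: is_derive_Afun.
- by move=> r /derivable_Afun_derive Ad; exact: derivableP.
Qed.
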